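(* Let $f$, $\phi$, $h$, $\mathcal{D}_{\mathrm{s}}$, $U$, $\mathcal{D}_0$, $\tau$, $\mathcal{D}$, $\omega$, $q$ and $V$ be as in the context, and suppose that all standing assumptions listed there, including the conditions (a)–(d) on $\omega$, hold. Then the function $V:\mathbb{R}^n\to\mathbb{R}\cup\{+\infty\}$ satisfies the following properties: (1) $V(x)<\infty$ if and only if $x\in\mathcal{D}$; (2) $V(x)\to\infty$ as $x\to\partial\mathcal{D}$; (3) $V$ is positive definite on $\mathcal{D}$ (i.e. $V(0)=0$ and $V(x)>0$ for $x\in\mathcal{D}\setminus\{0\}$); (4) $V$ is continuous on $\mathcal{D}$, and its right-hand derivative along solutions of $\dot x=f(x)$ satisfies $$\dot V(x):=\lim_{t\to0^+}\frac{V(\phi(t;x))-V(x)}{t}=-\omega(x)\quad\text{for all }x\in\mathcal{D}.$$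
   Context: System. $\dot x=f(x)$ on $\mathbb{R}^n$ with $f:\mathbb{R}^n\to\mathbb{R}^n$ locally Lipschitz. $\phi(t;x)$ is the unique solution with $\phi(0;x)=x$, assumed to exist for all $t\in[0,\infty)$. The origin is a locally asymptotically stable equilibrium point, with domain of attraction $\mathcal{D}_0=\{x\in\mathbb{R}^n:\lim_{t\to\infty}\|\phi(t;x)\|=0\}$ ($\|\cdot\|$ is the Euclidean norm). Safe set. $U\subseteq\mathbb{R}^n$ is the unsafe set and $\mathcal{D}_{\mathrm{s}}=\mathbb{R}^n\setminus U$. Assume $\mathcal{D}_{\mathrm{s}}=\{x\in\mathbb{R}^n:h(x)<1\}$ for some $h\in C^1(\mathbb{R}^n)$ with $\nabla h(x)\ne0$ on $\{x:h(x)=1\}$; $\mathcal{D}_{\mathrm{s}}$ is open and bounded; and $0\in\mathcal{D}_{\mathrm{s}}$. The system satisfies a stability-with-safety specification $(\mathcal{X}_0,U)$ for a set $\mathcal{X}_0\subseteq\mathbb{R}^n$ of initial conditions: $\mathcal{X}_0\subseteq\mathcal{D}_0$ and $\phi(t;x)\notin U$ for all $x\in\mathcal{X}_0$, $t\ge0$. Exit time and safe domain of attraction. $\tau(x)=\inf\{t\ge0:\phi(t;x)\in U\}$, with $\inf\emptyset=+\infty$. $\mathcal{D}=\{x\in\mathbb{R}^n:\lim_{t\to\infty}\|\phi(t;x)\|=0\text{ and }\phi(t;x)\notin U\ \forall t\ge0\}=\mathcal{D}_0\cap\{x:\tau(x)=+\infty\}$. Proper indicator. For an open set $D\ni0$,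 a continuous $\omega:D\to[0,\infty)$ is a proper indicator for the origin on $D$ if (i) $\omega(x)=0$ iff $x=0$; (ii) $\omega(x_m)\to\infty$ for any sequence $\{x_m\}\subset D$ with either $x_m\to p\in\partial D$ or $\|x_m\|\to\infty$. The function $V$. Given a proper indicator $\omega$ for the origin on $\mathcal{D}_{\mathrm{s}}$, define $$V(x)=\begin{cases}\int_0^{\tau(x)}\omega(\phi(t;x))\,dt+q(\phi(\tau(x);x)),&\tau(x)<\infty,\\ \int_0^\infty\omega(\phi(t;x))\,dt,&\tau(x)=\infty,\end{cases}$$ where the terminal cost $q$ satisfies $q(x)=\infty$ for $x\in\partial\mathcal{D}_{\mathrm{s}}\cup(\mathbb{R}^n\setminus\mathcal{D}_{\mathrm{s}})$ and $q=q_0$ on $\mathcal{D}_{\mathrm{s}}$, with $q_0\in C(\mathcal{D}_{\mathrm{s}})$ and $q_0(x)\to+\infty$ as $x\to\partial\mathcal{D}_{\mathrm{s}}$. Conditions on $\omega$. $\mathcal{D}_0\setminus\{0\}\neq\emptyset$, $\omega$ is a proper indicator for the origin on $\mathcal{D}_{\mathrm{s}}$, and: (a) for any $\delta>0$ there exists $c>0$ such that $\omega(x)>c$ for all $x\in\mathcal{D}_{\mathrm{s}}$ with $\|x\|>\delta$; (b) there exist an $r$-neighborhood of $\partial\mathcal{D}_{\mathrm{s}}$ ($r>0$) and a non-increasing function $\psi:\mathbb{R}_+\to\mathbb{R}_+$ with $\psi(s)\to\infty$ as $s\to0$ and $\int_0^r\psi(s)\,ds=\infty$, such that for some constant $C>0$,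 $\omega(x)\ge C\,\psi(\|x\|_{\partial\mathcal{D}_{\mathrm{s}}})$ for all $x\in\mathcal{D}_{\mathrm{s}}$ in that neighborhood, where $\|x\|_A=\inf_{y\in A}\|x-y\|$; (c) there exists $\rho>0$ such that $V(x)$ converges (is finite) for all $x$ with $\|x\|<\rho$; (d) for any $\varepsilon>0$ there exists $\delta>0$ such that $\|x\|<\delta$ implies $V(x)<\varepsilon$. *)

(* Defs.v *)
From HB Require Import structures.
From mathcomp Require Import all_boot all_order all_algebra.
From mathcomp Require Import all_classical all_reals all_analysis.

Set Implicit Arguments.
Unset Strict Implicit.
Unset Printing Implicit Defensive.

Import Order.TTheory GRing.Theory Num.Theory.
Import numFieldNormedType.Exports.

Local Open Scope classical_set_scope.
Local Open Scope ring_scope.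

(* Points of R^n are row vectors.  The norm
   `|x| that the library puts on 'rV[R]_n is the sup norm; it is equivalent to
   the Euclidean norm, so the library notions (open, closure, continuous,
   bounded_set, locally Lipschitz, differentiable) are the usual ones.
   Wherever a norm or a distance is written out, it is the Euclidean one. *)

Section Space.
Context {R : realType} {n : nat}.
Implicit Types (A D : set 'rV[R]_n) (x : 'rV[R]_n).

Definition enorm x : R := Num.sqrt (\sum_(i < n) x ord0 i ^+ 2).

Definition boundary A : set 'rV[R]_n := closure A `\` interior A.

(* The real-valued inf of the empty set is 0, so this is the distance to A
   only when A is nonempty. *)
Definition dist_to A x : R := inf [set enorm (x - y) | y in A].

Definition enbhd A (r : R) : set 'rV[R]_n :=
  [set x | exists2 y, A y & enorm (x - y) < r].

(* The filter "x --> A": the distance from x to A tends to 0. *)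
Definition near_set A : set_system 'rV[R]_n :=
  filter_from [set e : R | 0 < e] (enbhd A).

Definition grad (h : 'rV[R]_n -> R) x : 'rV[R]_n :=
  \row_(i < n) 'D_(delta_mx ord0 i) h x.

Definition is_C1 (h : 'rV[R]_n -> R) : Prop :=
  (forall x, differentiable h x) /\ continuous (grad h).

Definition locally_lipschitz (f : 'rV[R]_n -> 'rV[R]_n) : Prop :=
  forall x, exists2 A, nbhs x A & [lipschitz f y | y in A].

(* omega is a function on D: its values outside D are irrelevant. *)
Definition proper_indicator D (omega : 'rV[R]_n -> R) : Prop :=
  [/\ {within D, continuous omega},
      forall x, D x -> 0 <= omega x,
      forall x, D x -> (omega x = 0 <-> x = 0) &
      forall u : nat -> 'rV[R]_n, (forall m, D (u m)) ->
        (exists2 p, boundary D p & u m @[m --> \oo] --> p) \/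
        (enorm (u m) @[m --> \oo] --> +oo) ->
        omega (u m) @[m --> \oo] --> +oo].

End Space.

Section Flow.
Context {R : realType} {n : nat}.
Implicit Types (x : 'rV[R]_n) (U : set 'rV[R]_n).

(* y solves y' = f(y), y(0) = x on [0, +oo[; values of y at negative times are
   irrelevant.  For continuous f the equation then also holds at t = 0 for the
   right-hand derivative. *)
Definition forward_solution (f : 'rV[R]_n -> 'rV[R]_n) x (y : R -> 'rV[R]_n) :
    Prop :=
  [/\ y 0 = x,
      {within `[0, +oo[, continuous y} &
      forall t : R, 0 < t -> is_derive t (1 : R) y (f (y t))].

(* phi x t is the time-t value of the solution started at x. *)
Variable phi : 'rV[R]_n -> R -> 'rV[R]_n.

Definition attraction_domain : set 'rV[R]_n :=
  [set x | enorm (phi x t) @[t --> +oo] --> (0 : R)].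

Definition locally_asymptotically_stable : Prop :=
  (forall e, 0 < e -> exists2 d : R, 0 < d &
     forall x, enorm x < d -> forall t, 0 <= t -> enorm (phi x t) < e) /\
  (exists2 d : R, 0 < d & forall x, enorm x < d -> attraction_domain x).

Definition safe_attraction_domain U : set 'rV[R]_n :=
  attraction_domain `&` [set x | forall t, 0 <= t -> ~ U (phi x t)].

Definition exit_time U x : \bar R :=
  ereal_inf [set t%:E | t in [set t : R | 0 <= t /\ U (phi x t)]].

(* In the first case the integration interval excludes the endpoint tau(x),
   since phi(tau(x); x) may be outside the domain of omega. *)
Definition value_function U (omega : 'rV[R]_n -> R) (q : 'rV[R]_n -> \bar R) x :
    \bar R :=
  if (exit_time U x < +oo)%E then
    let T := fine (exit_time U x) in
    (\int[lebesgue_measure]_(t in `[0%R, T[) (omega (phi x t))%:E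
     + q (phi x T))%E
  else
    (\int[lebesgue_measure]_(t in `[0%R, +oo[) (omega (phi x t))%:E)%E.

End Flow.

(* Main.v *)
(* [V] is nonincreasing along trajectories and, on a trajectory that stays safe,
   [V x = \int_0^T omega (phi x t) dt + V (phi x T)].  If [V x] is finite then
   the trajectory is safe and, [omega] being bounded below away from the origin,
   it enters every ball around the origin; Lyapunov stability then yields
   convergence.  Conversely a convergent trajectory reaches a ball where [V] is
   finite.  Since [V] is small near the origin and the flow depends continuously
   on the initial point on compact time intervals, [V] is continuous on the open
   set where it is finite.

   At a boundary point [y] of [D], [V y = +oo] and one of three things happens:
   [y] lies on the boundary of [Ds], and near [y] the flow has bounded speed, so
   [omega] is bounded below by a divergent integrand; or the trajectory of [y]
   reaches the boundary of [Ds] in finite time, which reduces to the first case;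
   or it stays safe outside a ball around the origin, where [omega >= c > 0].
   Compactness of the boundary of [D] makes the blow-up uniform. *)

Require Import Defs.
From mathcomp Require Import all_boot all_order all_algebra.
From mathcomp Require Import all_classical all_reals all_analysis.
From mathcomp Require Import measurable_realfun ring lra.

Set Implicit Arguments.
Unset Strict Implicit.
Unset Printing Implicit Defensive.

Import Order.TTheory GRing.Theory Num.Theory.
Import numFieldNormedType.Exports.

Local Open Scope classical_set_scope.
Local Open Scope ring_scope.

(** * Sup norm against Euclidean norm, and uniformity over compact sets *)

Section Norms.
Context {R : realType} {n : nat}.
Implicit Types x y : 'rV[R]_n.

Lemma ler_coord_norm x i : `|x ord0 i| <= `|x|.
Proof.
by rewrite [leRHS]/Num.Def.normr/= mx_normrE; exact: (le_bigmax _ _ (ord0, i)).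
Qed.

Lemma norm_rV_le x (a : R) : 0 <= a -> (forall i, `|x ord0 i| <= a) -> `|x| <= a.
Proof.
move=> a0 xa; rewrite /Num.Def.normr/= mx_normrE; apply: bigmax_le => //= -[i j] _.
by rewrite ord1.
Qed.

Lemma enorm_ge0 x : 0 <= enorm x.
Proof. exact: sqrtr_ge0. Qed.

Lemma sumsq_ge0 x : 0 <= \sum_(i < n) x ord0 i ^+ 2.
Proof. by apply: sumr_ge0 => i _; exact: sqr_ge0. Qed.

Lemma normsq_le_sumsq x : `|x| ^+ 2 <= \sum_(i < n) x ord0 i ^+ 2.
Proof.
rewrite -[leRHS]sqr_sqrtr ?sumsq_ge0// ler_sqr ?nnegrE ?sqrtr_ge0//.
apply: norm_rV_le => [|i]; first exact: sqrtr_ge0.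
rewrite -sqrtr_sqr ler_sqrt ?sumsq_ge0// (bigD1 i)//= lerDl.
by apply: sumr_ge0 => j _; exact: sqr_ge0.
Qed.

Lemma sumsq_le_normsq x : \sum_(i < n) x ord0 i ^+ 2 <= n%:R * `|x| ^+ 2.
Proof.
apply: (@le_trans _ _ (\sum_(i < n) `|x| ^+ 2)); last first.
  by rewrite sumr_const card_ord mulr_natl.
apply: ler_sum => i _.
by rewrite -real_normK ?num_real// lerXn2r ?nnegrE// ler_coord_norm.
Qed.

Lemma norm_le_enorm x : `|x| <= enorm x.
Proof.
by rewrite -[`|x|]ger0_norm// -sqrtr_sqr ler_sqrt ?sumsq_ge0// normsq_le_sumsq.
Qed.

(** The constant [n.+1] avoids a square root and stays positive for [n = 0], so [enorm_lt] can
    divide by it. *)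
Lemma enorm_le_norm x : enorm x <= n.+1%:R * `|x|.
Proof.
rewrite -[leRHS]ger0_norm ?mulr_ge0// -sqrtr_sqr ler_sqrt ?sqr_ge0//.
rewrite (le_trans (sumsq_le_normsq x))// exprMn ler_wpM2r ?sqr_ge0//.
by rewrite -natrX ler_nat (leq_trans (leqnSn n))// leq_pmull.
Qed.

Lemma enorm_lt x (e : R) : `|x| < e / n.+1%:R -> enorm x < e.
Proof.
rewrite ltr_pdivlMr ?ltr0n// mulrC; exact: le_lt_trans (enorm_le_norm x).
Qed.

Lemma near_set_filter (A : set 'rV[R]_n) : Filter (near_set A).
Proof.
apply: filter_from_filter; first by exists 1; exact: ltr01.
move=> a b a0 b0; exists (Num.min a b); first by rewrite /= lt_min a0.
by move=> x [y Ay]; rewrite lt_min => /andP[xa xb]; split; exists y.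
Qed.

Lemma near_dist_lt x (e : R) : 0 < e -> \forall y \near x, `|x - y| < e.
Proof.
by move=> e0; apply/nbhs_ballP; exists e => //= y; rewrite -ball_normE.
Qed.

(** Lebesgue's number lemma: by the near-covering form of compactness, a radius [d] that works
    locally around each point of [K] can be chosen uniformly. *)
Lemma compact_uniform (K : set 'rV[R]_n) (P : 'rV[R]_n -> 'rV[R]_n -> Prop) :
  compact K -> (forall x, K x -> \forall p \near x & z \near x, P p z) ->
  exists2 d : R, 0 < d & forall p z, K p -> `|p - z| < d -> P p z.
Proof.
move=> /compact_near_coveringP/(_ R 0^'+
  (fun d p => forall z, `|p - z| < d -> P p z)) cK KP.
have {}cK := cK _ _.
near (0 : R)^'+ => d.
have d0 : 0 < d by near: d; exact: nbhs_right_gt.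
exists d => //.
move=> p z Kp; move: p Kp z; near: d; apply: cK => x /KP.
move=> [[A B] /= [Ax /nbhs_ballP[e /= e0 eB]] AB].
have e20 : 0 < e / 2 by rewrite divr_gt0.
near=> p u => z pz.
have Ap : A p by near: p.
have xp : `|x - p| < e / 2 by near: p; exact: near_dist_lt.
have ue : u < e / 2 by near: u; exact: nbhs_right_lt.
apply: (AB (p, z)); split => //=.
apply: eB; rewrite -ball_normE /= (le_lt_trans (ler_distD p x z))// [e]splitr ltrD//.
exact: lt_trans pz ue.
Unshelve. all: by end_near. Qed.

End Norms.

(** * Locally Lipschitz vector fields *)

Section Lipschitz.
Context {R : realType} {n : nat}.
Variable f : 'rV[R]_n -> 'rV[R]_n.
Hypothesis lipf : locally_lipschitz f.

Lemma locally_lipschitz_ball x : exists2 e : R, 0 < e &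
  exists2 L : R, 0 < L & forall y z, `|x - y| < e -> `|x - z| < e ->
    `|f y - f z| <= L * `|y - z|.
Proof.
have [A /nbhs_ballP[e /= e0 eA] [M [_ AM]]] := lipf x.
exists e => //; exists (`|M| + 1) => [|y z xy xz].
  by rewrite ltr_pwDr.
have := AM (`|M| + 1); rewrite (le_lt_trans (ler_norm _)) ?ltrDl//.
by move=> /(_ isT (y, z)); apply; split; apply: eA; rewrite -ball_normE.
Qed.

Lemma locally_lipschitz_continuous : continuous f.
Proof.
move=> x; have [e e0 [L L0 H]] := locally_lipschitz_ball x.
apply/(@cvgrPdist_lt _ _ _ (nbhs x)) => r r0.
have rL : 0 < r / L by rewrite divr_gt0.
near=> y; apply: le_lt_trans (H _ _ _ _) _.
- by rewrite subrr normr0.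
- by near: y; exact: near_dist_lt.
- rewrite mulrC -ltr_pdivlMr//; near: y; exact: near_dist_lt.
Unshelve. all: by end_near. Qed.

(** The point [z] may lie off [K], as perturbed trajectories do. In the proof [d] is the radius and
    [d^-1] the Lipschitz constant, so one limit [d -> 0+] settles both. *)
Lemma lipschitz_near_compact (K : set 'rV[R]_n) : compact K ->
  exists2 d : R, 0 < d & exists2 L : R, 0 < L &
    forall p z, K p -> `|p - z| < d -> `|f z - f p| <= L * `|z - p|.
Proof.
move=> /compact_near_coveringP/(_ R 0^'+
  (fun d p => forall z, `|p - z| < d -> `|f z - f p| <= d^-1 * `|z - p|)) cK.
have /cK /= : forall x, K x -> \forall p \near x & d \near 0^'+,
    forall z, `|p - z| < d -> `|f z - f p| <= d^-1 * `|z - p|.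
  move=> x _; have [e e0 [L L0 H]] := locally_lipschitz_ball x.
  have e20 : 0 < e / 2 by rewrite divr_gt0.
  have L10 : 0 < L^-1 by rewrite invr_gt0.
  near=> p d => z pz.
  have d0 : 0 < d by near: d; exact: nbhs_right_gt.
  have xp : `|x - p| < e / 2 by near: p; exact: near_dist_lt.
  have de : d < e / 2 by near: d; exact: nbhs_right_lt.
  have dL : d < L^-1 by near: d; exact: nbhs_right_lt.
  apply: (le_trans (H _ _ _ _)).
  - rewrite (le_lt_trans (ler_distD p x z))// [e]splitr ltrD//.
    exact: lt_trans pz de.
  - by rewrite (lt_trans xp)// [ltRHS]splitr ltrDl.
  - by rewrite ler_wpM2r// -[L]invrK lef_pV2 ?posrE// ltW.
move=> cK'.
near (0 : R)^'+ => d.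
have d0 : 0 < d by near: d; exact: nbhs_right_gt.
exists d => //; exists d^-1; first by rewrite invr_gt0.
by move=> p z Kp; move: p Kp z; near: d; exact: cK'.
Unshelve. all: by end_near. Qed.

End Lipschitz.

(** * Gronwall's inequality *)

Section Gronwall.
Context {R : realType}.

(** The product of [g] with [expR (- c * t)] has nonpositive derivative, so the mean value theorem
    compares its values at [0] and [T]. *)
Lemma gronwall (g dg : R -> R) (c T : R) : 0 <= T ->
  {within `[0, T], continuous g} ->
  (forall t, t \in `]0, T[ -> is_derive t 1 g (dg t)) ->
  (forall t, t \in `]0, T[ -> dg t <= c * g t) ->
  g T <= g 0 * expR (c * T).
Proof.
rewrite le_eqVlt => /predU1P[<- _ _ _|T0 gc gd dgc].
  by rewrite mulr0 expR0 mulr1.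
pose e t := expR (- c * t).
have ed t : is_derive t (1 : R) e (- c * e t).
  by rewrite /e; apply: is_derive_eq; rewrite /GRing.scale/= mulr1 mulrC.
have ec : continuous e.
  by move=> t; apply/differentiable_continuous/derivable1_diffP.
have gec : {within `[0, T], continuous (g * e)}.
  by move=> t; apply: continuousM; [exact: gc|exact: (continuous_subspaceT ec)].
have [t t0T] := MVT T0 (fun t tT => is_deriveM (gd t tT) (ed t)) gec.
move=> eT.
have : g T * e T <= g 0 * e 0.
  rewrite -subr_le0 [leLHS]eT pmulr_lle0 ?subr_gt0//.
  rewrite /GRing.scale/= mulrA [X in _ + X]mulrC -mulrDl pmulr_lle0 ?expR_gt0//.
  by rewrite mulrN addrC subr_le0 mulrC dgc.
rewrite /e mulr0 expR0 mulr1 mulNr expRN => H.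
by rewrite -ler_pdivrMr ?expR_gt0.
Qed.

End Gronwall.

(** * Continuous paths on the half-line *)

Section Clamp.
Context {R : realType} {V : topologicalType}.
Implicit Types y : R -> V.

(** Freezing the path at negative times turns continuity within [[0, +oo[] into continuity on the
    whole line. *)
Lemma clamp_continuous y : {within `[0, +oo[, continuous y} ->
  continuous (fun t : R => y (Num.max 0 t)).
Proof.
move=> yc t; have max_ge0 s : (`[0, +oo[%classic : set R) (Num.max 0 s).
  by rewrite /= in_itv/= le_max lexx.
have maxc : {for t, continuous ((cst 0 : R -> R^o) \max (id : R -> R^o))}.
  by apply: (@continuous_max _ _ (cst 0) id) => P; [move=> P0; exact: cst_continuous|].
move=> P Py; have /subspace_continuousP/(_ _ (max_ge0 t))/(_ P Py) H := yc.
have := maxc _ H; apply: (@filterS _ (nbhs (t : R))) => s Hs; exact: Hs (max_ge0 s).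
Qed.

(** The hitting times in [[0, s]] form a nonempty compact set, on which the identity attains its
    minimum. *)
Lemma first_hitting y (B : set V) (s : R) : {within `[0, +oo[, continuous y} ->
  closed B -> 0 <= s -> B (y s) ->
  exists t, [/\ 0 <= t <= s, B (y t) & forall r, 0 <= r < t -> ~ B (y r)].
Proof.
move=> yc Bcl s0 Bs; pose A := `[0, s] `&` (fun t : R => y (Num.max 0 t)) @^-1` B.
have A0 : A !=set0 by exists s; split => /=; rewrite ?in_itv/= ?s0 ?lexx// max_r.
have cA : compact A.
  apply: compact_closedI; first exact: segment_compact.
  by apply: closed_comp => // t _; exact: clamp_continuous.
have idc : {within A, continuous (id : R -> R)}.
  by apply: continuous_subspaceT => t; exact: cvg_id.
have [t] := compact_EVT_min A0 cA idc.
rewrite inE => -[/=]; rewrite in_itv/= => /andP[t0 ts]; rewrite max_r// => Bt tmin.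
exists t; split => //; first by rewrite t0.
move=> r /andP[r0 rt] Br.
have Ar : A r.
  by split => /=; rewrite ?max_r// in_itv/= r0 (le_trans (ltW rt)).
by have := tmin r; rewrite inE leNgt rt => /(_ Ar).
Qed.

End Clamp.

(** * Continuous dependence on the initial point *)

Section ForwardSolution.
Context {R : realType} {n : nat}.
Variable f : 'rV[R]_n -> 'rV[R]_n.
Implicit Types x : 'rV[R]_n.

Lemma is_derive_coord (y : R -> 'rV[R]_n) (t : R) l i :
  is_derive t (1 : R) y l -> is_derive t (1 : R) (fun s => y s ord0 i) (l ord0 i).
Proof.
move=> [yt <-]; have /derivable_mxP yij := yt; apply: DeriveDef; first exact: yij.
by rewrite derive_mx// mxE.
Qed.

Lemma sumsq_continuous : continuous (fun u : 'rV[R]_n => \sum_(i < n) u ord0 i ^+ 2).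
Proof.
apply: continuous_big => [|i _ u]; first exact: add_continuous.
by apply: continuousM; exact: coord_continuous.
Qed.

(* Gronwall's inequality for the square distance, up to the first time at
   which the second solution leaves the tube where [f] is Lipschitz. *)
Lemma forward_solution_dependence x (y : R -> 'rV[R]_n) (T : R) :
  locally_lipschitz f -> forward_solution f x y -> 0 <= T ->
  exists2 eta : R, 0 < eta & exists2 C : R, 0 < C &
    forall x' z, forward_solution f x' z -> `|x' - x| < eta ->
      forall t, 0 <= t <= T -> `|z t - y t| <= C * `|x' - x|.
Proof.
move=> lipf [y0 yc yd] T0.
have subT (s : R) : `[0, s] `<=` `[0, +oo[.
  by move=> t/=; rewrite !in_itv/= => /andP[->].
have cK : compact (y @` `[0, T]).
  apply: continuous_compact; last exact: segment_compact.
  exact: continuous_subspaceW (subT _) yc.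
have [d d0 [L L0 H]] := lipschitz_near_compact lipf cK.
(* The factor [n] comes from summing [n] coordinate terms, each at most [2 * L] times the squared
   sup norm. *)
pose c := 2 * n%:R * L.
have c0 : 0 <= c by rewrite !mulr_ge0// ltW.
(* Gronwall yields the factor [n * expR (c * T)] for squares; it is at most [C], hence at most
   [C ^ 2] because [C >= 1]. *)
pose C := n.+1%:R * expR (c * T).
have C1 : 1 <= C by rewrite mulr_ege1 ?ler1n// -expR0 ler_expR mulr_ge0.
have C0 : 0 < C by exact: lt_le_trans C1.
exists (d / C); first by rewrite divr_gt0.
exists C => // x' z [z0 zc zd]; rewrite ltr_pdivlMr// mulrC => xd.
pose sq (u : 'rV[R]_n) := \sum_(i < n) u ord0 i ^+ 2.
pose E t := sq (z t - y t).
pose dE t := \sum_(i < n)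
  (2 * (z t - y t) ord0 i * (f (z t) - f (y t)) ord0 i).
have Ecy : {within `[0, +oo[, continuous E}.
  apply: within_continuous_comp => [u _|t]; first exact: sumsq_continuous.
  by apply: cvgB; [exact: zc|exact: yc].
have Ec s : {within `[0, s], continuous E}.
  exact: continuous_subspaceW (subT s) Ecy.
have Ed (t : R) : 0 < t -> is_derive t (1 : R) E (dE t).
  move=> t0.
  have -> : E = \sum_(i < n) (fun s => (z s - y s) ord0 i) ^+ 2.
    by apply/funext => s; rewrite /E /sq fct_sumE; apply: eq_bigr.
  apply: is_derive_eq.
    apply: is_derive_sum => i; apply: is_deriveX.
    exact: is_derive_coord (is_deriveB (zd t t0) (yd t t0)).
  by apply: eq_bigr => i _; rewrite /GRing.scale/= expr1.
have usq t : `|z t - y t| ^+ 2 <= E t := normsq_le_sumsq (z t - y t).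
have dE_le t : 0 <= t <= T -> E t < d ^+ 2 -> dE t <= c * E t.
  move=> tT Et.
  have ud : `|y t - z t| < d.
    rewrite distrC -ltr_sqr ?nnegrE ?(ltW d0)//; exact: le_lt_trans (usq t) Et.
  have Kt : (y @` `[0, T]) (y t) by exists t => //=; rewrite in_itv.
  have fL := H _ _ Kt ud.
  apply: (@le_trans _ _ (\sum_(i < n) 2 * L * `|z t - y t| ^+ 2)).
    apply: ler_sum => i _; rewrite -!mulrA ler_wpM2l//.
    rewrite (le_trans (ler_norm _))// normrM.
    rewrite expr2 mulrCA ler_pM ?ler_coord_norm//.
    by rewrite (le_trans _ fL)// ler_coord_norm.
  rewrite sumr_const card_ord -[leLHS]mulr_natl.
  have -> w : n%:R * (2 * L * w) = c * w by rewrite /c; ring.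
  by rewrite ler_wpM2l.
have xC t : 0 <= t <= T -> (forall s, 0 <= s < t -> E s < d ^+ 2) ->
    E t <= (C * `|x' - x|) ^+ 2.
  move=> /andP[t0 tT] Es.
  apply: le_trans (gronwall (c := c) t0 (Ec t) _ _) _.
  - by move=> s; rewrite in_itv/= => /andP[s0 _]; exact: Ed.
  - move=> s; rewrite in_itv/= => /andP[s0 st]; apply: dE_le.
      by rewrite (ltW s0) (le_trans (ltW st)).
    by apply: Es; rewrite (ltW s0).
  - rewrite /E z0 y0 exprMn mulrC.
    apply: (@le_trans _ _ (expR (c * T) * (n%:R * `|x' - x| ^+ 2))).
      by rewrite ler_pM ?expR_ge0 ?sumsq_ge0 ?sumsq_le_normsq// ler_expR ler_wpM2l.
    rewrite mulrA ler_wpM2r ?sqr_ge0// expr2.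
    apply: (@le_trans _ _ C); last by rewrite ler_peMr// ltW.
    by rewrite mulrC ler_wpM2r ?expR_ge0// ler_nat.
have xCd : (C * `|x' - x|) ^+ 2 < d ^+ 2.
  by rewrite ltr_sqr ?nnegrE ?(ltW d0)// mulr_ge0// ltW.
move=> t tT; rewrite -ler_sqr ?nnegrE ?mulr_ge0 ?(ltW C0)//.
apply: le_trans (usq t) _; apply: (xC) => // s /andP[s0 st]; rewrite ltNge.
apply/negP => Es.
(* Before the first time [r] with [d ^ 2 <= E r] the tube has not been left, so [xC] applies up to
   [r] and forces [E r < d ^ 2]. *)
have [r [/andP[r0 rs] Er rmin]] := first_hitting Ecy (@closed_ge _ (d ^+ 2)) s0 Es.
have : E r <= (C * `|x' - x|) ^+ 2.
  apply: xC; first by move: tT => /andP[_]; rewrite r0/=; lra.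
  by move=> q qr; rewrite ltNge; apply/negP/rmin.
by move=> /le_lt_trans/(_ xCd); rewrite ltNge => /negP; apply.
Qed.

End ForwardSolution.

(** * Affine change of variables for Lebesgue measure *)

Section Affine.
Context {R : realType}.
Local Notation mu := (@lebesgue_measure R).

Lemma preimage_affine_itv (a b c d : R) : 0 < b ->
  (fun t => b * t + a) @^-1` `]c, d] = `](c - a) / b, (d - a) / b]%classic.
Proof.
move=> b0; apply/seteqP; split=> t /=; rewrite !in_itv/= ltr_pdivrMr// ler_pdivlMr//;
  by rewrite ltrBlDr lerBrDr [t * b]mulrC.
Qed.

Lemma measurable_affine (a b : R) :
  measurable_fun setT (fun t : measurableTypeR R => b * t + a : measurableTypeR R).
Proof.
apply: continuous_measurable_fun => t.
by apply: cvgD; [apply: cvgM; [exact: cvg_cst|exact: cvg_id]|exact: cvg_cst].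
Qed.

(** The right-hand side is a scaled pushforward of [mu] that agrees with [mu] on the intervals []c,
    d]], and these determine Lebesgue measure. *)
Lemma lebesgue_measure_affine (a b : R) (b0 : 0 < b) (A : set (measurableTypeR R)) :
  measurable A ->
  mu A = (b%:E * mu ((fun t => b * t + a)%R @^-1` A))%E.
Proof.
move=> mA; have mF := measurable_affine a b.
have -> : (b%:E * mu ((fun t => b * t + a)%R @^-1` A))%E = mscale (NngNum (ltW b0))
    (pushforward mu (fun t => b * t + a : measurableTypeR R)) A by [].
apply: lebesgue_measure_unique => //= _ [[c d]] _ <-.
rewrite /mscale/= /pushforward/= preimage_affine_itv// !lebesgue_measure_itv/=.
rewrite !lte_fin ltr_pM2r ?invr_gt0// ltrD2r.
case: ifPn => _; last by rewrite mule0.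
by rewrite -!EFinD -EFinM; congr EFin; field; rewrite gt_eqF.
Qed.

Lemma ge0_integral_affine (a b : R) (A : set R) (f : R -> \bar R) :
  0 < b -> measurable A -> measurable_fun A f ->
  (forall x, A x -> (0 <= f x)%E) ->
  (\int[mu]_(x in A) f x =
   b%:E * \int[mu]_(t in (fun t => b * t + a)%R @^-1` A) f (b * t + a)%R)%E.
Proof.
move=> b0 mA mf f0.
rewrite -(ge0_integral_pushforward (measurable_affine a b))//; last first.
  by move=> x; rewrite inE; exact: f0.
have mF := measurable_affine a b.
rewrite -[b%:E in RHS]/((NngNum (ltW b0))%:num%:E).
rewrite -ge0_integral_mscale//.
by apply: eq_measure_integral => B mB _; exact: lebesgue_measure_affine.
Qed.

End Affine.

(** * Integrals over intervals *)

Section LineIntegrals.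
Context {R : realType}.
Local Notation mu := (@lebesgue_measure R).

Lemma ge0_integral_shift (a : R) (f : R -> \bar R) :
  measurable_fun `[a, +oo[ f -> (forall x, a <= x -> (0 <= f x)%E) ->
  (\int[mu]_(x in `[a, +oo[) f x = \int[mu]_(t in `[0%R, +oo[) f (t + a)%R)%E.
Proof.
move=> mf f0; rewrite (ge0_integral_affine a (ltr01 : 0 < 1))//; last first.
  by move=> x /=; rewrite in_itv/= andbT; exact: f0.
rewrite mul1e; have -> : (fun t => 1 * t + a) @^-1` `[a, +oo[ = `[0, +oo[%classic.
  by apply/seteqP; split => t /=; rewrite !in_itv/= !andbT mul1r lerDr.
by apply: eq_integral => t _; rewrite mul1r.
Qed.

(** Monotonicity makes the superlevel sets of [psi] in []0, +oo[] intervals; nothing is assumed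
    about [psi] at nonpositive arguments. *)
Lemma nonincreasing_gt0_measurable (psi : R -> R) (A : set R) :
  measurable A -> A `<=` [set s | 0 < s] ->
  (forall s t, 0 < s -> s <= t -> psi t <= psi s) -> measurable_fun A psi.
Proof.
move=> mA A0 psi_ni; apply: (@measurable_funS _ _ _ _ (`]0, +oo[%classic : set R)) => //.
  by move=> s /A0; rewrite /= in_itv/= andbT.
apply: (measurability (@RGenCInfty.G R)) => [|/= _ [_] [x] -> <-].
  exact: RGenCInfty.measurableE.
apply: is_interval_measurable => s t/= [s0 sx] [t0 tx] u /andP[su ut].
move: s0 t0 sx tx; rewrite /= !in_itv/= !andbT => s0 t0 sx tx.
have u0 : 0 < u by exact: lt_le_trans su.
by split => //; rewrite (le_trans tx)// psi_ni.
Qed.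

(** The substitution [s = B * t] keeps the integral infinite, and monotone convergence along
    [[1 / (k + 1), r / B]] carries it past [M]. The positive [e] leaves room for moving the initial
    point in [blowup_boundary]. *)
Lemma integral_scale_diverges (psi : R -> R) (r B M : R) : 0 < r -> 0 < B ->
  (forall s, 0 < s -> 0 <= psi s) ->
  (forall s t, 0 < s -> s <= t -> psi t <= psi s) ->
  (\int[mu]_(s in `]0%R, r]) (psi s)%:E = +oo)%E ->
  exists2 e : R, 0 < e &
    (M%:E < \int[mu]_(t in `[e, (r / B)%R]) (psi (B * t)%R)%:E)%E.
Proof.
move=> r0 B0 psi0 psi_ni.
rewrite (ge0_integral_affine 0 B0)//; last 2 first.
- apply/measurable_EFinP; apply: nonincreasing_gt0_measurable => // s.
  by rewrite /= in_itv/= => /andP[].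
- by move=> s; rewrite /= in_itv/= => /andP[s0 _]; rewrite lee_fin psi0.
rewrite preimage_affine_itv// !(subr0, mul0r) => psioo.
pose F n := `[n.+1%:R^-1, r / B]%classic : set R.
have FE : \bigcup_n F n = `]0, r / B]%classic.
  apply/seteqP; split=> [t [n _]|t]; rewrite /F/= !in_itv/=.
    by move=> /andP[nt ->]; rewrite andbT (lt_le_trans _ nt).
  move=> /andP[nt tB]; have [n nt'] := ltr_add_invr (y := 0) nt.
  by exists n => //=; rewrite in_itv/= tB andbT ltW// -[X in X < _]add0r.
have Bpsi_ni s t : 0 < s -> s <= t -> psi (B * t) <= psi (B * s).
  by move=> s0 st; rewrite psi_ni ?mulr_gt0// ler_pM2l.
have F0 n : F n `<=` [set s | 0 < s].
  by move=> s; rewrite /F/= in_itv/= => /andP[+ _]; apply: lt_le_trans.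
have /cvgeyPgt /(_ M) : (\int[mu]_(x in F i) (psi (B * x)%R)%:E @[i --> \oo] --> +oo)%E.
  have -> : +oo%E = (\int[mu]_(x in `]0%R, (r / B)%R]) (psi (B * x)%R)%:E)%E.
    (* Since [B > 0], a product with [B] equal to [+oo] forces the integral itself to be [+oo]. *)
    apply/esym; move: psioo; under eq_integral do rewrite addr0.
    by move: (integral _ _ _) => [s|//|] /=; rewrite ?gt0_muley ?lte_fin// gt0_muleNy.
  rewrite -FE; apply: ge0_nondecreasing_set_cvg_integral.
  - move=> m k mk; apply/subsetPset => t; rewrite /F/= !in_itv/= => /andP[+ ->].
    rewrite andbT; apply: le_trans.
    by rewrite lef_pV2 ?posrE// ler_nat.
  - by move=> i; exact: measurable_itv.
  - move=> i; apply/measurable_EFinP;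
    apply: nonincreasing_gt0_measurable (F0 i) Bpsi_ni; exact: measurable_itv.
  - by move=> i t /F0 t0; rewrite lee_fin psi0// mulr_gt0.
by move=> [n _ /(_ n (leqnn n)) Fn]; exists n.+1%:R^-1.
Qed.

(** The extra term is the integral of the constant [e]; exchanging [g1] and [g2] yields two-sided
    estimates. *)
Lemma le_integral_add (g1 g2 : R -> R) (T e : R) : 0 <= T -> 0 <= e ->
  measurable_fun `[0, T[ (EFin \o g1) -> measurable_fun `[0, T[ (EFin \o g2) ->
  (forall t, 0 <= t < T -> [/\ 0 <= g1 t, 0 <= g2 t & g1 t <= g2 t + e]) ->
  (\int[mu]_(t in `[0%R, T[) (g1 t)%:E <=
   \int[mu]_(t in `[0%R, T[) (g2 t)%:E + (e * T)%:E)%E.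
Proof.
move=> T0 e0 mg1 mg2 H.
have -> : (e * T)%:E = (\int[mu]_(t in `[0%R, T[) (e%:E))%E.
  rewrite integral_cst//= lebesgue_measure_itv/= lte_fin.
  move: T0; rewrite le_eqVlt => /predU1P[<-|T0]; first by rewrite ltxx mulr0 mule0.
  by rewrite T0 -EFinD -EFinM subr0.
rewrite -ge0_integralD//; last first.
  by move=> t /=; rewrite in_itv/= => /H[]; rewrite lee_fin.
apply: ge0_le_integral => //.
- by move=> t /=; rewrite in_itv/= => /H[]; rewrite lee_fin.
- exact: emeasurable_funD.
- by move=> t /=; rewrite in_itv/= => /H[_ _]; rewrite lee_fin.
Qed.

End LineIntegrals.

(** * Time translation and uniqueness of solutions *)

Section Translation.
Context {R : realType} {n : nat}.
Variable f : 'rV[R]_n -> 'rV[R]_n.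

Lemma is_derive_translate (y : R -> 'rV[R]_n) (s t : R) l :
  is_derive (s + t) (1 : R) y l -> is_derive t (1 : R) (fun u => y (s + u)) l.
Proof.
have E : (fun h : R => h^-1 *: (y (s + (h *: 1 + t)) - y (s + t))) =
         (fun h : R => h^-1 *: (y (h *: 1 + (s + t)) - y (s + t))).
  by apply/funext => h; rewrite addrCA.
move=> [yd <-]; apply: DeriveDef; first by rewrite /derivable/= E.
by rewrite /derive/= E.
Qed.

Lemma forward_solution_translate x (y : R -> 'rV[R]_n) (s : R) : 0 <= s ->
  forward_solution f x y -> forward_solution f (y s) (fun t => y (s + t)).
Proof.
move=> s0 [y0 yc yd]; split; first by rewrite addr0.
(* The clamped translate agrees with [y (s + t)] for [t >= 0] and is continuous on the whole
   line. *)
- apply: (@subspace_eq_continuous _ _ _ (fun t : R => y (Num.max 0 (s + t)))).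
    move=> t; rewrite inE/= in_itv/= andbT => t0.
    by rewrite max_r// addr_ge0.
  apply: continuous_subspaceT => t.
  apply: (@continuous_comp _ _ _ (fun t => s + t) (fun t => y (Num.max 0 t))).
    by apply: cvgD; [exact: cvg_cst|exact: cvg_id].
  exact: clamp_continuous.
- by move=> t t0; apply: is_derive_translate; apply: yd; rewrite ltr_wpDl.
Qed.

(** Continuous dependence with equal initial points gives the bound [C * 0]. *)
Lemma forward_solution_unique x (y z : R -> 'rV[R]_n) (t : R) :
  locally_lipschitz f -> forward_solution f x y -> forward_solution f x z ->
  0 <= t -> z t = y t.
Proof.
move=> lipf ys zs t0.
have [eta eta0 [C _ /(_ _ _ zs)]] := forward_solution_dependence lipf ys t0.
rewrite subrr normr0 => /(_ eta0 t); rewrite t0 lexx mulr0 normr_le0 subr_eq0.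
by move=> /(_ isT)/eqP.
Qed.

End Translation.

(** * The flow and the value function *)

Section System.
Context {R : realType} {n : nat}.
Variables (f : 'rV[R]_n -> 'rV[R]_n) (phi : 'rV[R]_n -> R -> 'rV[R]_n).
Variables (U : set 'rV[R]_n) (omega : 'rV[R]_n -> R) (q : 'rV[R]_n -> \bar R).
Hypothesis lipf : locally_lipschitz f.
Hypothesis sol : forall x, forward_solution f x (phi x).
Hypothesis Ds_open : open (~` U).
Hypothesis q_unsafe : forall x, U x -> q x = +oo%E.
Hypothesis omega_cont : {within ~` U, continuous omega}.
Hypothesis omega_ge0 : forall x, ~ U x -> 0 <= omega x.
Local Notation V := (value_function phi U omega q).
Local Notation mu := (@lebesgue_measure R).
Implicit Types (x : 'rV[R]_n) (s t T : R).

Lemma flow0 x : phi x 0 = x. Proof. by have [] := sol x. Qed.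

Lemma flow_semigroup x s t : 0 <= s -> 0 <= t -> phi (phi x s) t = phi x (s + t).
Proof.
move=> s0 t0; apply: (forward_solution_unique (y := fun u => phi x (s + u)) lipf) t0.
  exact: forward_solution_translate.
exact: sol.
Qed.

Definition safe x := forall t, 0 <= t -> ~ U (phi x t).

Lemma safe_shift x s : 0 <= s -> safe x -> safe (phi x s).
Proof. by move=> s0 sx t t0; rewrite flow_semigroup//; apply: sx; rewrite addr_ge0. Qed.

Lemma safe_concat x T : 0 <= T -> (forall t, 0 <= t <= T -> ~ U (phi x t)) ->
  safe (phi x T) -> safe x.
Proof.
move=> T0 sT s t t0; have [tT|/ltW Tt] := leP t T; first by apply: sT; rewrite t0.
by rewrite -(subrKC T t) -flow_semigroup ?subr_ge0//; apply: s; rewrite subr_ge0.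
Qed.

(** [U] is closed, so the exit time is attained. *)
Lemma unsafe_exit x : ~ safe x ->
  exists T, [/\ 0 <= T, U (phi x T) & forall t, 0 <= t < T -> ~ U (phi x t)].
Proof.
move=> /existsNP[s /not_implyP[s0 /contrapT Us]].
have Ucl : closed U by rewrite -(setCK U); exact: open_closedC.
have [_ cx _] := sol x.
have [T [/andP[T0 _] UT Tmin]] := first_hitting cx Ucl s0 Us.
by exists T.
Qed.

Lemma value_safe x : safe x ->
  V x = (\int[mu]_(t in `[0%R, +oo[) (omega (phi x t))%:E)%E.
Proof.
move=> sx; rewrite /value_function.
suff -> : exit_time phi U x = +oo%E by rewrite ltxx.
by apply/ereal_inf_pinfty => y [t [t0 Ut] _]; case: (sx t).
Qed.

(** The exit point lies in [U], where [q] is infinite, and the running cost is nonnegative because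
    [omega] is only integrated before the exit. *)
Lemma value_unsafe x : ~ safe x -> V x = +oo%E.
Proof.
move=> /unsafe_exit[T [T0 UT Tmin]]; rewrite /value_function.
have -> : exit_time phi U x = T%:E.
  apply/eqP; rewrite eq_le; apply/andP; split.
    by apply: ereal_inf_lbound; exists T.
  apply/ereal_infP => _ [t [t0 Ut] <-]; rewrite lee_fin leNgt.
  by apply/negP => tT; apply: (Tmin t) => //; rewrite t0.
rewrite ltry /= q_unsafe// addey// gt_eqF// (lt_le_trans ltNy0)//.
apply: integral_ge0 => t /=; rewrite in_itv/= => tT.
by rewrite lee_fin omega_ge0//; exact: Tmin.
Qed.

Lemma value_ge0 x : (0 <= V x)%E.
Proof.
have [sx|/value_unsafe->] := pselect (safe x); last by rewrite leey.
rewrite value_safe//; apply: integral_ge0 => t /=; rewrite in_itv/= andbT => t0.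
by rewrite lee_fin omega_ge0//; exact: sx.
Qed.

Lemma value_lty_safe x : (V x < +oo)%E -> safe x.
Proof. by move=> Vx; apply: contrapT => /value_unsafe V'; rewrite V' ltxx in Vx. Qed.

Lemma omega_continuous_at x : ~ U x -> {for x, continuous omega}.
Proof.
move: omega_cont; rewrite continuous_open_subspace// => oc Ux.
by apply: oc; rewrite inE.
Qed.

Lemma omega_flow_continuous x : safe x ->
  continuous (fun t : R => omega (phi x (Num.max 0 t))).
Proof.
move=> sx t; have [_ cx _] := sol x.
have oc : {for phi x (Num.max 0 t), continuous omega}.
  by apply: omega_continuous_at; apply: sx; rewrite le_max lexx.
have pc : {for t, continuous (fun s : R => phi x (Num.max 0 s))}.
  exact: clamp_continuous.
exact: (cvg_comp _ _ pc oc).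
Qed.

Lemma omega_flow_measurable x (A : set R) : safe x -> measurable A ->
  A `<=` `[0, +oo[ -> measurable_fun A (fun t => (omega (phi x t))%:E).
Proof.
move=> sx mA A0; apply/measurable_EFinP.
apply: (eq_measurable_fun (fun t : R => omega (phi x (Num.max 0 t)))).
  by move=> t; rewrite inE => /A0 /=; rewrite in_itv/= andbT => t0; rewrite max_r.
apply: measurable_funTS.
exact: (continuous_measurable_fun (omega_flow_continuous sx)).
Qed.

(** Dynamic programming: the semigroup property turns the integral over [[T, +oo[] into
    [V (phi x T)]. Both sides may be infinite. *)
Lemma value_split x T : safe x -> 0 <= T ->
  V x = (\int[mu]_(t in `[0%R, T[) (omega (phi x t))%:E + V (phi x T))%E.
Proof.
move=> sx T0; rewrite !value_safe//; last exact: safe_shift.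
have E : `[0, +oo[%classic = `[0, T[ `|` `[T, +oo[ :> set R.
  apply/seteqP; split => t /=; rewrite !in_itv/= !andbT.
    by move=> t0; have [?|?] := ltP t T; [left; rewrite t0|right].
  by case=> [/andP[]//|]; exact: le_trans.
rewrite [in LHS]E ge0_integral_setU//=.
- congr (_ + _)%E; rewrite ge0_integral_shift//.
  + apply: eq_integral => t; rewrite inE/= in_itv/= andbT => t0.
    by rewrite flow_semigroup// addrC.
  + apply: omega_flow_measurable => // t /=; rewrite !in_itv/= !andbT.
    exact: le_trans.
  + by move=> t Tt; rewrite lee_fin omega_ge0//; apply: sx; exact: le_trans Tt.
- apply: omega_flow_measurable => //; first exact: measurableU.
  move=> t /= [|]; rewrite !in_itv/= !andbT; first by case/andP.
  exact: le_trans.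
- move=> t /= Ht; rewrite lee_fin omega_ge0//; apply: sx; move: Ht => [|].
    by rewrite in_itv/= => /andP[].
  by rewrite in_itv/= andbT; exact: le_trans.
- apply/disj_setPS => t /= []; rewrite !in_itv/= andbT => /andP[_ tT].
  by rewrite leNgt tT.
Qed.

Lemma value_decr x t : safe x -> 0 <= t -> (V (phi x t) <= V x)%E.
Proof.
move=> sx t0; rewrite (value_split sx t0) leeDr//.
apply: integral_ge0 => s /=; rewrite in_itv/= => /andP[s0 _].
by rewrite lee_fin omega_ge0//; exact: sx.
Qed.

(** Discarding times outside [A] only lowers the cost. The positivity and blow-up estimates rest on
    this bound. *)
Lemma value_ge_integral x (A : set R) (g : R -> \bar R) : safe x ->
  measurable A -> A `<=` `[0, +oo[ -> measurable_fun A g ->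
  (forall t, A t -> (0 <= g t)%E) ->
  (forall t, A t -> (g t <= (omega (phi x t))%:E)%E) ->
  (\int[mu]_(t in A) g t <= V x)%E.
Proof.
move=> sx mA A0 mg g0 gle; rewrite value_safe//.
have om0 t : 0 <= t -> (0 <= (omega (phi x t))%:E)%E.
  by move=> t0; rewrite lee_fin omega_ge0//; exact: sx.
apply: (@le_trans _ _ (\int[mu]_(t in A) (omega (phi x t))%:E)%E).
  by apply: ge0_le_integral => //; exact: omega_flow_measurable.
apply: ge0_subset_integral => //.
  exact: omega_flow_measurable.
by move=> t /=; rewrite in_itv/= andbT; exact: om0.
Qed.

Lemma value_ge_cst x (c a b : R) : safe x -> 0 <= c -> 0 <= a <= b ->
  (forall t, a <= t <= b -> c <= omega (phi x t)) -> ((c * (b - a))%:E <= V x)%E.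
Proof.
move=> sx c0 /andP[a0 ab] cle.
apply: le_trans (@value_ge_integral x `[a, b] (fun=> c%:E) sx _ _ _ _ _) => //.
- rewrite integral_cst//= lebesgue_measure_itv/= lte_fin.
  move: ab; rewrite le_eqVlt => /predU1P[->|ab]; last by rewrite ab -EFinD -EFinM.
  by rewrite ltxx subrr mulr0 mule0.
- by move=> t /=; rewrite !in_itv/= andbT => /andP[+ _]; exact: le_trans.
Qed.

(** [omega] is continuous along a safe trajectory, hence bounded on the segment [[0, T]]. *)
Lemma integral_omega_lty x T : safe x -> 0 <= T ->
  (\int[mu]_(t in `[0%R, T[) (omega (phi x t))%:E < +oo)%E.
Proof.
move=> sx T0; pose g (t : R) := omega (phi x (Num.max 0 t)).
have [t _ gt] := EVT_max T0 (continuous_subspaceT (omega_flow_continuous sx)).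
have om0 s : 0 <= s -> 0 <= omega (phi x s) by move=> s0; rewrite omega_ge0//; exact: sx.
apply: (@le_lt_trans _ _ (\int[mu]_(s in `[0%R, T[) (g t)%:E)%E).
  apply: ge0_le_integral => //.
  - by move=> s /=; rewrite in_itv/= lee_fin => /andP[/om0].
  - apply: omega_flow_measurable => // s /=; rewrite !in_itv/= andbT => /andP[].
    by [].
  - move=> s /=; rewrite in_itv/= => /andP[s0 sT].
    by have := gt s; rewrite in_itv/= s0 ltW// max_r// lee_fin; apply.
rewrite integral_cst//= lebesgue_measure_itv/= lte_fin.
by case: ifPn => _; rewrite ?mule0 ?ltry// -EFinD -EFinM ltry.
Qed.

(** * Finiteness of [V] and the safe domain of attraction *)

Hypothesis stable : forall e, 0 < e -> exists2 d : R, 0 < d &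
  forall x, enorm x < d -> forall t, 0 <= t -> enorm (phi x t) < e.
Hypothesis omega_away : forall d : R, 0 < d -> exists2 c : R, 0 < c &
  forall x, ~ U x -> d < enorm x -> c < omega x.
Hypothesis value_near0 : exists2 rho : R, 0 < rho &
  forall x, enorm x < rho -> (V x < +oo)%E.

(** A bounded stretch of safe trajectory has finite cost, so finiteness of [V] propagates
    backwards. *)
Lemma value_lty_split x T : 0 <= T -> (forall t, 0 <= t <= T -> ~ U (phi x t)) ->
  (V (phi x T) < +oo)%E -> (V x < +oo)%E.
Proof.
move=> T0 sT VT; have sx := safe_concat T0 sT (value_lty_safe VT).
rewrite (value_split sx T0) lte_add_pinfty//; exact: integral_omega_lty.
Qed.

(** Otherwise [omega] exceeds [c] forever, and the cost up to time [N = V x / c + 1] is at least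
    [V x + c]. *)
Lemma enters_ball x (d : R) : 0 < d -> (V x < +oo)%E ->
  exists2 t, 0 <= t & enorm (phi x t) <= d.
Proof.
move=> d0 Vx; have sx := value_lty_safe Vx; apply: contrapT => /forall2NP H.
have [c c0 cle] := omega_away d0.
have Vfin : V x \is a fin_num by rewrite ge0_fin_numE// value_ge0.
pose N := fine (V x) / c + 1.
have N0 : 0 <= N by rewrite addr_ge0// divr_ge0 ?(ltW c0)// fine_ge0// value_ge0.
have /(_ _) := @value_ge_cst x c 0 N sx (ltW c0).
rewrite lexx N0 => /(_ isT) K.
have : ((c * (N - 0))%:E <= V x)%E.
  apply: K => t /andP[t0 _]; apply/ltW/cle; first exact: sx.
  by rewrite ltNge; apply/negP; case: (H t).
rewrite -[V x]fineK// lee_fin subr0 /N mulrDr mulrCA divff ?gt_eqF// mulr1.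
by rewrite mulr1 gerDl leNgt c0.
Qed.

Lemma value_ltyP x : (V x < +oo)%E <-> safe_attraction_domain phi U x.
Proof.
split=> [Vx|[/= ax sx]].
  have sx := value_lty_safe Vx; split => //=.
  apply/cvgrPdist_lt => e e0; have [d d0 Hd] := stable e0.
  (* [enters_ball] gives a non-strict bound; halving [d] makes it strict, as stability requires. *)
  have [s s0 sd] := enters_ball (divr_gt0 d0 (ltr0n _ 2)) Vx.
  have {}sd : enorm (phi x s) < d.
    by apply: le_lt_trans sd _; rewrite ltr_pdivrMr// ltr_pMr// ltr1n.
  exists s; split; first exact: num_real.
  move=> t /ltW st; rewrite sub0r normrN ger0_norm ?enorm_ge0//.
  by rewrite -(subrKC s t) -flow_semigroup ?subr_ge0// Hd// subr_ge0.
have [rho rho0 Hrho] := value_near0.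
move/cvgrPdist_lt : ax => /(_ _ rho0) [M [_ HM]].
pose T := `|M| + 1; have T0 : 0 <= T by rewrite addr_ge0.
apply: (@value_lty_split x T T0) => [t /andP[t0 _]|]; first exact: sx.
apply: Hrho; have := HM T; rewrite (le_lt_trans (ler_norm _)) ?ltrDl// => /(_ isT).
by rewrite sub0r normrN ger0_norm ?enorm_ge0.
Qed.

Lemma flow_compact x T : compact (phi x @` `[0, T]).
Proof.
have [_ cx _] := sol x.
apply: continuous_compact; last exact: segment_compact.
by apply: continuous_subspaceW cx => t/=; rewrite !in_itv/= => /andP[->].
Qed.

Lemma flow_tracking x T (e : R) : 0 <= T -> 0 < e ->
  exists2 eta : R, 0 < eta & forall x', `|x - x'| < eta ->
    forall t, 0 <= t <= T -> `|phi x t - phi x' t| < e.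
Proof.
move=> T0 e0.
have [eta eta0 [C C0 H]] := forward_solution_dependence lipf (sol x) T0.
exists (Num.min eta (e / C)); first by rewrite lt_min eta0 divr_gt0.
move=> x'; rewrite lt_min distrC => /andP[xeta xC] t tT.
rewrite distrC (le_lt_trans (H _ _ (sol x') xeta t tT))//.
by rewrite mulrC -ltr_pdivlMr.
Qed.

(** The trajectory up to [T] is a compact subset of the open safe set, on which [omega] is
    continuous. Both conclusions therefore hold in a uniform tube around it, where nearby
    trajectories stay. *)
Lemma omega_tracking x T (e : R) : 0 <= T -> 0 < e ->
  (forall t, 0 <= t <= T -> ~ U (phi x t)) ->
  exists2 eta : R, 0 < eta & forall x', `|x - x'| < eta ->
    forall t, 0 <= t <= T ->
      ~ U (phi x' t) /\ `|omega (phi x t) - omega (phi x' t)| <= e.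
Proof.
move=> T0 e0 sT.
have [p Kp|d d0 H] := @compact_uniform _ _ _
   (fun p z => ~ U z /\ `|omega p - omega z| <= e) (@flow_compact x T).
  have Up : ~ U p by move: Kp => [t /=]; rewrite in_itv/= => tT <-; exact: sT.
  have nU : \forall z \near p, ~ U z by exact: open_nbhs_nbhs.
  have np : \forall z \near p, `|omega p - omega z| < e / 2.
    have /cvgrPdist_lt := omega_continuous_at Up; apply.
    by rewrite divr_gt0.
  near=> p' z.
  have Uz : ~ U z by near: z.
  have pp' : `|omega p - omega p'| < e / 2 by near: p'.
  have pz : `|omega p - omega z| < e / 2 by near: z.
  split=> //=; rewrite (le_trans (ler_distD (omega p) _ _))// [e]splitr.
  by rewrite lerD ?(ltW pz)// distrC ltW.
have [eta eta0 Heta] := flow_tracking x T0 d0.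
exists eta => // x' xx' t tT; apply: (H _ _ _ (Heta _ xx' t tT)).
by exists t => //=; rewrite in_itv.
Unshelve. all: by end_near. Qed.

Lemma flow_into_ball x (e : R) : 0 < e -> (V x < +oo)%E ->
  exists2 T, 0 <= T & exists2 eta : R, 0 < eta & forall x', `|x - x'| < eta ->
    enorm (phi x' T) < e /\ forall t, 0 <= t <= T -> ~ U (phi x' t).
Proof.
move=> e0 Vx; have sx := value_lty_safe Vx.
(* Dividing by [n.+1] passes from the Euclidean to the sup norm; the factor [2] splits the budget
   between the position of [phi x T] and the tracking error. *)
pose d := e / n.+1%:R / 2.
have d0 : 0 < d by rewrite !divr_gt0.
have [T T0 Td] := enters_ball d0 Vx; exists T => //.
have [eta1 eta10 H1] := flow_tracking x T0 d0.
have [|eta2 eta20 H2] := @omega_tracking x T 1 T0 ltr01.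
  by move=> t /andP[t0 _]; exact: sx.
exists (Num.min eta1 eta2); first by rewrite lt_min eta10.
move=> x'; rewrite lt_min => /andP[x1 x2]; split.
  apply: enorm_lt; rewrite [ltRHS]splitr -/d.
  rewrite -(subrK (phi x T) (phi x' T)) (le_lt_trans (ler_normD _ _))// ltr_leD//.
    by rewrite distrC; apply: H1; rewrite // T0 lexx.
  exact: le_trans (norm_le_enorm _) Td.
by move=> t tT; have [] := H2 _ x2 t tT.
Qed.

(** Trajectories from nearby points safely reach, at the common time [T], the ball where [V] is
    finite. *)
Lemma value_lty_open : open [set x | (V x < +oo)%E].
Proof.
rewrite openE => x /= Vx; have [rho rho0 Hrho] := value_near0.
have [T T0 [eta eta0 H]] := flow_into_ball rho0 Vx.
apply/nbhs_ballP; exists eta => //= y; rewrite -ball_normE => /H [yT yU].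
by apply: (value_lty_split T0 yU); exact: Hrho.
Qed.

(** * Blow-up of [V] at the boundary *)

Hypothesis Ds_bounded : bounded_set (~` U).
Variables (r C : R) (psi : R -> R).
Hypothesis r_gt0 : 0 < r.
Hypothesis C_gt0 : 0 < C.
Hypothesis psi_ge0 : forall s, 0 < s -> 0 <= psi s.
Hypothesis psi_ni : forall s t, 0 < s -> s <= t -> psi t <= psi s.
Hypothesis psi_diverges : (\int[mu]_(s in `]0%R, r]) (psi s)%:E = +oo)%E.
Hypothesis omega_ge_psi : forall x, ~ U x -> enbhd (boundary (~` U)) r x ->
  C * psi (dist_to (boundary (~` U)) x) <= omega x.

Lemma boundary_unsafe x : boundary (~` U) x -> U x.
Proof.
by rewrite /boundary ((interior_id _).1 Ds_open) => -[_ /contrapT].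
Qed.

Lemma dist_to_boundary_le x z : boundary (~` U) z ->
  dist_to (boundary (~` U)) x <= enorm (x - z).
Proof.
by move=> Bz; apply: ge_inf; [exists 0 => _ [y _ <-]; exact: enorm_ge0|exists z].
Qed.

(** Boundary points are unsafe, so a safe ball around [x] contains none. Nonemptiness matters
    because the real infimum of the empty set is [0]. *)
Lemma dist_to_boundary_gt0 x : boundary (~` U) !=set0 -> ~ U x ->
  0 < dist_to (boundary (~` U)) x.
Proof.
move=> [z Bz] Ux; have : nbhs x (~` U) by exact: open_nbhs_nbhs.
move=> /nbhs_ballP[e /= e0 eU]; apply: (lt_le_trans e0); apply: lb_le_inf.
  by exists (enorm (x - z)), z.
move=> _ [y /boundary_unsafe Uy <-]; rewrite leNgt; apply/negP => xy.
apply: (eU y) => //; rewrite -ball_normE /=.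
exact: le_lt_trans (norm_le_enorm _) xy.
Qed.

Lemma closure_safe_compact : compact (closure (~` U)).
Proof.
have [M [_ HM]] := Ds_bounded.
pose N := `|M| + 1.
have sub : closure (~` U) `<=` [set x | `|x| <= N].
  have UN : ~` U `<=` [set x | `|x| <= N].
    by move=> x; apply: HM => //; rewrite (le_lt_trans (ler_norm _)) ?ltrDl.
  suff /closure_id -> : closed [set x : 'rV[R]_n | `|x| <= N] by exact: closureS.
  have -> : [set x : 'rV[R]_n | `|x| <= N] = Num.norm @^-1` [set y | y <= N] by [].
  by apply: closed_comp (@closed_le _ N) => x _; exact: norm_continuous.
apply: bounded_closed_compact; last exact: closed_closure.
by exists N; split => [|b Nb x /sub /le_trans]; [exact: num_real|apply; exact: ltW].
Qed.

Lemma speed_bound : exists2 K : R, 0 < K & forall x, ~ U x -> `|f x| <= K.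
Proof.
have fc : {within closure (~` U), continuous f}.
  exact/continuous_subspaceT/locally_lipschitz_continuous.
have [M [_ HM]] := compact_bounded (continuous_compact fc closure_safe_compact).
exists (`|M| + 1) => [|x Ux]; first by rewrite ltr_wpDl.
apply: HM; first by rewrite (le_lt_trans (ler_norm _)) ?ltrDl.
by exists x => //; exact: subset_closure.
Qed.

(** The mean value theorem is applied to each coordinate; in the sup norm this loses no constant. *)
Lemma flow_speed x (K t : R) : (forall y, ~ U y -> `|f y| <= K) -> safe x ->
  0 <= t -> `|phi x t - x| <= K * t.
Proof.
move=> fK sx t0; have [x0 cx dx] := sol x.
have K0 : 0 <= K by exact: le_trans (fK _ (sx _ (lexx 0))).
apply: norm_rV_le => [|i]; first exact: mulr_ge0.
have c0t : {within `[0, t], continuous (phi x)}.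
  by apply: continuous_subspaceW cx => s/=; rewrite !in_itv/= => /andP[->].
have ci : {within `[0, t], continuous (fun s => phi x s ord0 i)}.
  apply: (@within_continuous_comp _ _ _ _ (phi x) (fun u : 'rV[R]_n => u ord0 i));
    last exact: c0t.
  by move=> u _; exact: coord_continuous.
have di s : s \in `]0, t[ -> is_derive s (1 : R) (fun s => phi x s ord0 i)
    (f (phi x s) ord0 i).
  by rewrite in_itv/= => /andP[s0 _]; exact: is_derive_coord (dx s s0).
have [c] := MVT_segment t0 di ci.
rewrite in_itv/= x0 subr0 => /andP[c0 _] E.
rewrite mxE [X in _ + X]mxE [X in `|X|]E normrM (ger0_norm t0) ler_wpM2r//.
by rewrite (le_trans (ler_coord_norm _ _))// fK//; exact: sx.
Qed.

(* Near [z] the flow has speed at most [K], so its distance to the boundary at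
   time [t >= e] is at most [B * t], where [B = 2 (n + 1) K]; hence [V] is at
   least the integral of [C * psi (B * t)] over [[e, r / B]]. *)
Lemma blowup_boundary z (M : R) : boundary (~` U) z ->
  exists2 eta : R, 0 < eta & forall x, `|z - x| < eta -> (M%:E < V x)%E.
Proof.
move=> Bz; have [K K0 fK] := speed_bound.
pose B := 2 * n.+1%:R * K.
have B0 : 0 < B by rewrite !mulr_gt0.
have [e e0 He] := integral_scale_diverges (M / C) r_gt0 B0 psi_ge0 psi_ni psi_diverges.
(* For [t >= e] the initial offset [K * e] is at most [K * t], which explains the factor [2] in
   [B]. *)
exists (K * e); first exact: mulr_gt0.
move=> x zx; have [sx|/value_unsafe->] := pselect (safe x); last exact: ltry.
have mB : measurable_fun `[e, r / B] (fun t => (psi (B * t))%:E).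
  apply/measurable_EFinP.
  apply: (@nonincreasing_gt0_measurable _ (fun t => psi (B * t))) => //.
    by move=> t /=; rewrite in_itv/= => /andP[+ _]; exact: lt_le_trans.
  by move=> s t s0 st; rewrite psi_ni ?mulr_gt0// ler_pM2l.
have pB t : `[e, r / B]%classic t -> (0 <= (psi (B * t))%:E)%E.
  rewrite /= in_itv/= => /andP[et _]; rewrite lee_fin psi_ge0// mulr_gt0//.
  exact: lt_le_trans et.
apply: (@lt_le_trans _ _ (\int[mu]_(t in `[e, (r / B)%R]) (C%:E * (psi (B * t)%R)%:E))%E).
  rewrite ge0_integralZl_EFin//; last exact: ltW.
  by rewrite -[M](divfK (lt0r_neq0 C_gt0)) mulrC EFinM lte_pmul2l// lte_fin.
apply: value_ge_integral => //.
- by move=> t /=; rewrite !in_itv/= andbT => /andP[+ _]; apply: le_trans; exact: ltW.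
- exact: measurable_funeM.
- by move=> t /pB pt; rewrite mule_ge0// lee_fin ltW.
move=> t /=; rewrite in_itv/= => /andP[et tB].
have t0 : 0 <= t by rewrite (le_trans (ltW e0)).
have Ut : ~ U (phi x t) by exact: sx.
have tz : enorm (phi x t - z) < B * t.
  apply: (le_lt_trans (enorm_le_norm _)).
  have -> : B * t = n.+1%:R * (K * t + K * t) by rewrite /B; ring.
  rewrite ltr_pM2l ?ltr0n// -(subrK x (phi x t)) -addrA.
  rewrite (le_lt_trans (ler_normD _ _))// ler_ltD ?flow_speed//.
  by rewrite distrC (lt_le_trans zx)// ler_pM2l.
rewrite -EFinM lee_fin; apply: le_trans (omega_ge_psi Ut _); last first.
  by exists z => //; rewrite (lt_le_trans tz)// mulrC -ler_pdivlMr.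
rewrite ler_pM2l// psi_ni//; first by apply: dist_to_boundary_gt0 => //; exists z.
exact: le_trans (dist_to_boundary_le _ Bz) (ltW tz).
Qed.

(** The exit point is a limit of earlier safe points, but is itself unsafe. When [T = 0] there are
    no earlier points, and the hypothesis on [x] takes over. *)
Lemma exit_boundary x T : closure (~` U) x -> 0 <= T -> U (phi x T) ->
  (forall t, 0 <= t < T -> ~ U (phi x t)) -> boundary (~` U) (phi x T).
Proof.
move=> cx T0 UT Tmin; split; last by rewrite ((interior_id _).1 Ds_open); apply.
have [T00|Tn0] := eqVneq T 0; first by rewrite T00 flow0.
have Tgt0 : 0 < T by rewrite lt_neqAle eq_sym Tn0.
move=> A; rewrite -{1}(max_r T0) => nA; have [_ cphi _] := sol x.
have /nbhs_ballP[e /= e0 eA] : nbhs T ((fun t : R => phi x (Num.max 0 t)) @^-1` A).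
  exact: (clamp_continuous cphi).
have e20 : 0 < e / 2 by rewrite divr_gt0.
(* This time lies in [[0, T[] and within [e / 2] of [T]. *)
pose t := T - Num.min T (e / 2).
have m0 : 0 < Num.min T (e / 2) by rewrite lt_min Tgt0.
have t0 : 0 <= t by rewrite subr_ge0 ge_min lexx.
have tT : t < T by rewrite ltrBlDr ltrDl.
exists (phi x t); split; first by apply: Tmin; rewrite t0.
rewrite -(max_r t0); apply: eA; rewrite -ball_normE/= /t opprB addrC subrK.
by rewrite gtr0_norm// gt_min [X in _ || X]ltr_pdivrMr// ltr_pMr// ltr1n orbT.
Qed.

Lemma blowup_infinite x (M : R) : closure (~` U) x -> V x = +oo%E ->
  exists2 eta : R, 0 < eta & forall x', `|x - x'| < eta -> (M%:E < V x')%E.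
Proof.
move=> cx Vx; have [sx|/unsafe_exit[T [T0 UT Tmin]]] := pselect (safe x); last first.
  (* Nearby trajectories that stay safe are, at time [T], close to the boundary point [phi x T], and
     [V] does not increase along them. *)
  have [d d0 Hd] := blowup_boundary M (exit_boundary cx T0 UT Tmin).
  have [eta eta0 Heta] := flow_tracking x T0 d0.
  exists eta => // x' xx'.
  have [sx'|/value_unsafe->] := pselect (safe x'); last exact: ltry.
  apply: lt_le_trans (value_decr sx' T0); apply: Hd; apply: Heta => //.
  by rewrite T0 lexx.
have [rho rho0 Hrho] := value_near0.
have far t : 0 <= t -> rho <= enorm (phi x t).
  move=> t0; rewrite leNgt; apply/negP => /Hrho xt.
  suff : (V x < +oo)%E by rewrite Vx ltxx.
  by apply: (value_lty_split t0 _ xt) => s /andP[s0 _]; exact: sx.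
(* In the sup norm the trajectory of [x] stays at least [rho / n.+1 = 2 * d] from the origin;
   tracking within [d] leaves more than [d] for [x']. *)
pose d := rho / n.+1%:R / 2; have d0 : 0 < d by rewrite !divr_gt0.
have [c c0 Hc] := omega_away d0.
(* Spending time [N] at rate [c] costs [|M| + c], which exceeds [M]. *)
pose N := `|M| / c + 1.
have N0 : 0 <= N by rewrite addr_ge0// divr_ge0// ltW.
have [eta eta0 Heta] := flow_tracking x N0 d0.
exists eta => // x' xx'.
have [sx'|/value_unsafe->] := pselect (safe x'); last exact: ltry.
apply: (@lt_le_trans _ _ (c * (N - 0))%:E).
  rewrite lte_fin subr0 /N mulrDr mulrCA divff ?gt_eqF// !mulr1.
  by rewrite (le_lt_trans (ler_norm _))// ltrDl.
apply: value_ge_cst; rewrite ?lexx ?(ltW c0)// => t tN.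
have t0 : 0 <= t by case/andP: tN.
apply/ltW/Hc; first exact: sx'.
apply: lt_le_trans (norm_le_enorm _).
have xt : rho / n.+1%:R <= `|phi x t|.
  by rewrite ler_pdivrMr ?ltr0n// mulrC (le_trans (far t t0))// enorm_le_norm.
have := Heta _ xx' t tN; have := ler_distD (phi x' t) (phi x t) 0.
rewrite !subr0 => /(le_trans xt); rewrite [X in X <= _]splitr -/d => h1 h2.
by have := le_lt_trans h1 (ltr_leD h2 (lexx _)); rewrite ltrD2l.
Qed.

Lemma boundary_lty_compact : compact (boundary [set x | (V x < +oo)%E]).
Proof.
apply: subclosed_compact closure_safe_compact _.
  apply: closedI; first exact: closed_closure.
  by apply: open_closedC; exact: open_interior.
move=> x [cx _]; apply: closureS cx => y Vy.
by have := value_lty_safe Vy (lexx 0); rewrite flow0.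
Qed.

(** Openness of the finiteness set puts [V = +oo] on its boundary; [blowup_infinite] gives a radius
    at each point, and compactness a common one. *)
Lemma value_cvg_boundary :
  V x @[x --> near_set (boundary [set x | (V x < +oo)%E])] --> +oo%E.
Proof.
have FF := near_set_filter (boundary [set x | (V x < +oo)%E]).
apply/cvgeyPgt => M.
have [|d d0 Hd] := @compact_uniform _ _ _ (fun _ x => (M%:E < V x)%E) boundary_lty_compact.
  move=> x [cx nx].
  have Vx : V x = +oo%E.
    apply/eqP; rewrite -leye_eq leNgt; apply/negP => Vx; apply: nx.
    by rewrite ((interior_id _).1 value_lty_open).
  have ccx : closure (~` U) x.
    apply: closureS cx => y Vy.
    by have := value_lty_safe Vy (lexx 0); rewrite flow0.
  have [eta eta0 Heta] := blowup_infinite M ccx Vx.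
  near=> p z; have xz : `|x - z| < eta by near: z; exact: near_dist_lt.
  exact: Heta.
exists d => // x [y By xy]; apply: (Hd y) => //.
by rewrite distrC (le_lt_trans (norm_le_enorm _)).
Unshelve. all: by end_near. Qed.

(** * Positivity, continuity and derivative of [V] *)

Lemma value_le_add x y T (e1 e2 : R) : 0 <= T -> 0 <= e1 -> safe x -> safe y ->
  (forall t, 0 <= t <= T -> omega (phi y t) <= omega (phi x t) + e1) ->
  (V (phi y T) <= e2%:E)%E -> (V y <= V x + (e1 * T + e2)%:E)%E.
Proof.
(* Both values are split at [T]; [e2] bounds the tail from [y], while the tail from [x] is
   nonnegative and dropped. *)
move=> T0 e10 sx sy H Vy; rewrite (value_split sy T0) EFinD addeA leeD//.
have sub0 : `[0, T[%classic `<=` (`[0, +oo[%classic : set R).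
  by move=> t /=; rewrite !in_itv/= andbT => /andP[].
apply: (@le_trans _ _ (\int[mu]_(t in `[0%R, T[) (omega (phi x t))%:E + (e1 * T)%:E)%E).
  apply: le_integral_add => //; [exact: omega_flow_measurable..|].
  move=> t /andP[t0 tT]; split; last by apply: H; rewrite t0 ltW.
    by apply: omega_ge0; exact: sy.
  by apply: omega_ge0; exact: sx.
by rewrite leeD2r// (value_split sx T0) leeDl// value_ge0.
Qed.

Lemma omega_flow_near0 x (e : R) : 0 < e -> safe x ->
  exists2 d : R, 0 < d & forall t, 0 <= t < d -> `|omega x - omega (phi x t)| < e.
Proof.
move=> e0 sx; have : {for 0, continuous (fun t : R => omega (phi x (Num.max 0 t)))}.
  exact: omega_flow_continuous.
move=> /cvgrPdist_lt/(_ _ e0)/nbhs_ballP[d /= d0 Hd]; exists d => // t /andP[t0 td].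
have := Hd t; rewrite maxxx flow0 max_r//; apply.
by rewrite -ball_normE/= sub0r normrN ger0_norm.
Qed.

Hypothesis omega_eq0 : forall x, ~ U x -> (omega x = 0 <-> x = 0).
Hypothesis value_small : forall e : R, 0 < e -> exists2 d : R, 0 < d &
  forall x, enorm x < d -> (V x < e%:E)%E.

Lemma value_at0 : V 0 = 0%E.
Proof.
apply/eqP; rewrite eq_le value_ge0 andbT; apply/lee_addgt0Pr => e /value_small[d d0 Hd].
rewrite add0e ltW// Hd//; apply: enorm_lt.
by rewrite normr0 divr_gt0.
Qed.

(** On a safe trajectory [omega] stays above half its positive initial value for a short time, which
    already has a positive cost. *)
Lemma value_gt0 x : x <> 0 -> (0 < V x)%E.
Proof.
move=> x0; have [sx|/value_unsafe->] := pselect (safe x); last exact: ltry.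
have Ux : ~ U x by rewrite -(flow0 x); exact: sx.
have ox : 0 < omega x.
  rewrite lt_neqAle omega_ge0// andbT; apply/eqP => /esym ox.
  by apply: x0; exact/(omega_eq0 Ux).
have ox2 : 0 < omega x / 2 by rewrite divr_gt0.
have [d d0 Hd] := omega_flow_near0 ox2 sx.
have d2 : 0 < d / 2 by rewrite divr_gt0.
apply: (@lt_le_trans _ _ (omega x / 2 * (d / 2 - 0))%:E).
  by rewrite subr0 lte_fin mulr_gt0.
apply: value_ge_cst; rewrite ?lexx ?(ltW ox2) ?(ltW d2)// => t /andP[t0 td].
have := Hd t; rewrite t0 (le_lt_trans td) ?ltr_pdivrMr ?ltr_pMr ?ltr1n// => /(_ isT).
move=> /(le_lt_trans (ler_norm _)); rewrite ltrBlDr => H.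
by rewrite ltW// -(ltrD2l (omega x / 2)) -splitr.
Qed.

(** Half of [e] pays for the tails after a common time [T], at which nearby trajectories lie in a
    ball where [V < e / 2]; the other half pays for the difference of running costs on [[0, T]]. *)
Lemma value_continuous x : (V x < +oo)%E -> V y @[y --> x] --> V x.
Proof.
move=> Vx; have sx := value_lty_safe Vx.
have nVlty : \forall y \near x, (V y < +oo)%E.
  exact: (open_nbhs_nbhs (conj value_lty_open Vx)).
rewrite -[V x]fineK ?ge0_fin_numE ?value_ge0//; apply/(@fine_cvgP _ _ (nbhs x)); split.
  near=> y; rewrite ge0_fin_numE ?value_ge0//; near: y; exact: nVlty.
apply/(@cvgrPdist_le _ _ _ (nbhs x)) => e e0.
have e20 : 0 < e / 2 by rewrite divr_gt0.
have [d d0 Hd] := value_small e20.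
have [T T0 [eta1 eta10 H1]] := flow_into_ball d0 Vx.
(* Dividing by [T + 1] rather than [T] allows [T = 0]. *)
pose e1 := e / 2 / (T + 1).
have T1 : 0 < T + 1 by rewrite ltr_wpDl.
have e10 : 0 < e1 by rewrite !divr_gt0.
have [|eta2 eta20 H2] := omega_tracking T0 e10 (x := x).
  by move=> t /andP[t0 _]; exact: sx.
have e1T : e1 * T + e / 2 <= e.
  rewrite [leRHS]splitr lerD2r /e1 mulrAC ler_pdivrMr// ler_pM2l// lerDl.
  exact: ler01.
near=> y.
have Vy : (V y < +oo)%E by near: y.
have xy1 : `|x - y| < eta1 by near: y; exact: near_dist_lt.
have xy2 : `|x - y| < eta2 by near: y; exact: near_dist_lt.
have sy := value_lty_safe Vy.
have le_fine u v : (V u < +oo)%E -> (V v < +oo)%E ->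
    (V v <= V u + (e1 * T + e / 2)%:E)%E -> fine (V v) <= fine (V u) + e.
  move=> Vu Vv; rewrite -[V u]fineK ?ge0_fin_numE ?value_ge0//.
  rewrite -[V v]fineK ?ge0_fin_numE ?value_ge0// lee_fin => /le_trans; apply.
  by rewrite lerD2l.
have [yT _] := H1 _ xy1.
have xT : enorm (phi x T) < d by have [] := H1 x; rewrite ?subrr ?normr0.
rewrite /= ler_distlC lerBlDr; apply/andP; split.
  apply: le_fine => //; apply: (value_le_add T0 (ltW e10) sy sx).
    move=> t tT; have [_] := H2 _ xy2 t tT.
    by move=> /(le_trans (ler_norm _)); rewrite lerBlDl.
  by rewrite ltW// Hd.
apply: le_fine => //; apply: (value_le_add T0 (ltW e10) sx sy).
  move=> t tT; have [_] := H2 _ xy2 t tT.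
  by rewrite distrC => /(le_trans (ler_norm _)); rewrite lerBlDl.
by rewrite ltW// Hd.
Unshelve. all: by end_near. Qed.

(** By [value_split] the quotient is minus the mean of [omega] along the trajectory over [[0, t[],
    and continuity at time [0] gives the limit. *)
Lemma value_derivative x : (V x < +oo)%E ->
  ((V (phi x t) - V x) * (t^-1)%:E)%E @[t --> 0^'+] --> (- omega x)%:E.
Proof.
move=> Vx; have sx := value_lty_safe Vx.
pose I (t : R) := (\int[mu]_(s in `[0%R, t[) (omega (phi x s))%:E)%E.
have om0 s : 0 <= s -> 0 <= omega (phi x s).
  by move=> s0; apply: omega_ge0; exact: sx.
have Ifin t : 0 <= t -> I t \is a fin_num.
  move=> t0; rewrite ge0_fin_numE; first exact: integral_omega_lty.
  apply: integral_ge0 => s /=; rewrite in_itv/= lee_fin => /andP[s0 _]; exact: om0.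
(* Finiteness of all terms lets the extended-real quotient be computed in [R]. *)
have quotE t : 0 < t ->
    ((V (phi x t) - V x) * (t^-1)%:E)%E = (- (fine (I t) / t))%:E.
  move=> t0; have Vxt := value_decr sx (ltW t0).
  have Vtfin : V (phi x t) \is a fin_num.
    by rewrite ge0_fin_numE ?value_ge0// (le_lt_trans Vxt).
  rewrite (value_split sx (ltW t0)) -/(I t) -[I t]fineK ?Ifin ?ltW//.
  rewrite -[V (phi x t)]fineK//= -EFinD -EFinM; congr EFin.
  ring.
apply/fine_cvgP; split.
  by near=> t; rewrite quotE.
apply/cvgrPdist_le => e e0; have [d d0 Hd] := omega_flow_near0 e0 sx.
near=> t.
have t0 : 0 < t by near: t; exact: nbhs_right_gt.
have td : t < d by near: t; exact: nbhs_right_lt.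
rewrite /= quotE//= opprK addrC ler_distl.
have sub0 : `[0, t[%classic `<=` (`[0, +oo[%classic : set R).
  by move=> s /=; rewrite !in_itv/= andbT => /andP[].
have mI := omega_flow_measurable sx (measurable_itv `[0, t[) sub0.
have mc (c : R) : measurable_fun `[0, t[ (EFin \o (fun=> c)) by exact: measurable_cst.
have cI (c : R) : (\int[mu]_(s in `[0%R, t[) (c%:E) = (c * t)%:E)%E.
  by rewrite integral_cst//= lebesgue_measure_itv/= lte_fin t0 -EFinD -EFinM subr0.
have ox := om0 _ (lexx 0); rewrite flow0 in ox.
have Hs s : 0 <= s < t -> `|omega x - omega (phi x s)| < e.
  by move=> /andP[s0 st]; apply: Hd; rewrite s0 (lt_trans st).
have Ile : (I t <= (omega x * t)%:E + (e * t)%:E)%E.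
  rewrite -cI; apply: (le_integral_add (ltW t0) (ltW e0) mI (mc _)) => s st.
  have [s0 _] := andP st; split => //; first exact: om0.
  have := Hs s st; rewrite distrC => /ltW/(le_trans (ler_norm _)).
  by rewrite lerBlDl.
have Ige : ((omega x * t)%:E <= I t + (e * t)%:E)%E.
  rewrite -cI; apply: (le_integral_add (ltW t0) (ltW e0) (mc _) mI) => s st.
  have [s0 _] := andP st; split => //; first exact: om0.
  have := Hs s st => /ltW/(le_trans (ler_norm _)).
  by rewrite lerBlDl.
move: Ile Ige; rewrite -(fineK (Ifin t (ltW t0))) -!EFinD !lee_fin -!mulrDl.
rewrite -ler_pdivrMr//= => Ile; rewrite -lerBlDr -mulrBl -ler_pdivlMr// => Ige.
by apply/andP; split.
Unshelve. all: by end_near. Qed.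

End System.

Theorem theorem2 (R : realType) (n : nat)
  (f : 'rV[R]_n -> 'rV[R]_n) (phi : 'rV[R]_n -> R -> 'rV[R]_n)
  (h : 'rV[R]_n -> R) (U Ds : set 'rV[R]_n)
  (omega q0 : 'rV[R]_n -> R) (q : 'rV[R]_n -> \bar R)
  (D0 := attraction_domain phi) (D := safe_attraction_domain phi U)
  (V := value_function phi U omega q) :
  locally_lipschitz f ->
  (forall x, forward_solution f x (phi x)) ->
  f 0 = 0 -> locally_asymptotically_stable phi ->
  Ds = ~` U -> Ds = [set x | h x < 1] ->
  is_C1 h -> (forall x, h x = 1 -> grad h x <> 0) ->
  open Ds -> bounded_set Ds -> Ds 0 ->
  (forall x, (boundary Ds `|` ~` Ds) x -> q x = +oo%E) ->
  (forall x, Ds x -> q x = (q0 x)%:E) ->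
  {within Ds, continuous q0} ->
  (q0 x @[x --> within Ds (near_set (boundary Ds))] --> +oo) ->
  (D0 `\ 0) !=set0 ->
  proper_indicator Ds omega ->
  (forall d : R, 0 < d -> exists2 c : R, 0 < c &
     forall x, Ds x -> d < enorm x -> c < omega x) ->
  (exists r : R, exists psi : R -> R, exists C : R,
     [/\ 0 < r /\ 0 < C,
         (forall s, 0 < s -> 0 <= psi s) /\
         (forall s t, 0 < s -> s <= t -> psi t <= psi s),
         psi s @[s --> 0^'+] --> +oo,
         (\int[lebesgue_measure]_(s in `]0%R, r]) (psi s)%:E = +oo)%E &
         forall x, Ds x -> enbhd (boundary Ds) r x ->
           C * psi (dist_to (boundary Ds) x) <= omega x]) ->
  (exists2 rho : R, 0 < rho & forall x, enorm x < rho -> (V x < +oo)%E) ->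
  (forall e : R, 0 < e -> exists2 d : R, 0 < d &
     forall x, enorm x < d -> (V x < e%:E)%E) ->
  [/\ forall x, (V x < +oo)%E <-> D x,
      V x @[x --> near_set (boundary D)] --> +oo%E,
      V 0 = 0%E /\ (forall x, D x -> x <> 0 -> (0 < V x)%E) &
      {within D, continuous V} /\
      (forall x, D x ->
         ((V (phi x t) - V x) * (t^-1)%:E)%E @[t --> 0^'+] -->
           (- omega x)%:E)].
Proof.
move=> lipf sol _ [stable _] DsU _ _ _ Dopen Dbnd _ q_oo _ _ _ _.
move=> [omega_cont omega_ge0 omega_eq0 _] omega_away.
move=> [r [psi [C [[r0 C0] [psi0 psi_ni] _ psi_oo omega_psi]]]] V_near0 V_small.
subst Ds.
have q_unsafe x : U x -> q x = +oo%E by move=> Ux; apply: q_oo; right; exact.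
have DE x : (V x < +oo)%E <-> D x by exact: value_ltyP.
have DV : D = [set x | (V x < +oo)%E] by apply/seteqP; split=> x /DE.
split.
- exact: DE.
- rewrite DV; exact: (value_cvg_boundary lipf sol Dopen q_unsafe omega_cont omega_ge0
    omega_away V_near0 Dbnd r0 C0 psi0 psi_ni psi_oo omega_psi).
- split=> [|x _ x0].
    exact: (value_at0 sol Dopen q_unsafe omega_ge0 V_small).
  exact: (value_gt0 sol Dopen q_unsafe omega_cont omega_ge0 omega_eq0 x0).
- split=> [|x /DE Vx].
    (* [D] is open, being the set where [V] is finite, so continuity within [D] is continuity at
       each of its points. *)
    rewrite continuous_open_subspace => [x|]; rewrite DV; last first.
      exact: (value_lty_open lipf sol Dopen q_unsafe omega_cont omega_ge0 omega_away
        V_near0).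
    rewrite inE => Vx; exact: (value_continuous lipf sol Dopen q_unsafe omega_cont
      omega_ge0 omega_away V_near0 V_small Vx).
  exact: (value_derivative lipf sol Dopen q_unsafe omega_cont omega_ge0 Vx).
Qed.
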